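(* Let $p\geq 5$ be any fixed prime integer, and let $\varphi_{p-1,c}$ be a map defined by $\varphi_{p-1,c}(z)=z^{p-1}+c$ for $c,z\in\mathbb{Z}$. Then the number of distinct integral fixed points of any map $\varphi_{p-1,c}$ modulo $p$ is $1$ or $2$ or zero.
   Context: The number of distinct integral fixed points of $\varphi_{p-1,c}$ modulo $p$ (for $c\in\mathbb{Z}$) means $\#\{z\in\mathbb{Z}/p\mathbb{Z} : \varphi_{p-1,c}(z)-z\equiv 0 \pmod p\}$. *)

(* Defs.v *)
From mathcomp Require Import all_boot all_order all_algebra.
Set Implicit Arguments. Unset Strict Implicit. Unset Printing Implicit Defensive.
Import Order.TTheory GRing.Theory Num.Theory.
Local Open Scope ring_scope.

Definition phi (d : nat) (c z : int) : int := z ^+ d + c.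

(* A class z : 'Z_p is evaluated through its representative in {0, ..., p - 1};
   for f = phi d c, mem_fixed_points_mod shows the choice of representative is
   irrelevant.
   For p < 2, 'Z_p is not Z/pZ, so 1 < p is needed for the intended meaning. *)
Definition fixed_points_mod (p : nat) (f : int -> int) : {set 'Z_p} :=
  [set z : 'Z_p | (f (z : nat)%:Z - (z : nat)%:Z == 0 %[mod p])%Z].

Lemma phi_fixed_modz (p d : nat) (c x y : int) :
  (x = y %[mod p])%Z ->
  (phi d c x - x == 0 %[mod p])%Z = (phi d c y - y == 0 %[mod p])%Z.
Proof.
move=> xy; suff -> : ((phi d c x - x) = (phi d c y - y) %[mod p])%Z by [].
rewrite /phi -modzDm -[RHS]modzDm; congr ((_ + _) %% _)%Z.
  by rewrite -modzDml -modzXm xy modzXm modzDml.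
by rewrite -modzNm xy modzNm.
Qed.

Lemma mem_fixed_points_mod (p d : nat) (c x : int) : (1 < p)%N ->
  (x%:~R \in fixed_points_mod p (phi d c)) = (phi d c x - x == 0 %[mod p])%Z.
Proof.
move=> p_gt1; rewrite inE; apply: phi_fixed_modz.
have p_neq0 : p%:Z != 0 by case: p p_gt1.
have /gez0_abs : 0 <= (x %% p)%Z by rewrite modz_ge0.
set n := absz _ => nE.
have -> : x%:~R = n%:R :> 'Z_p.
  rewrite {1}(divz_eq x p) -nE intrD intrM.
  by rewrite -[p%:~R]/(p%:R : 'Z_p) pchar_Zp // mulr0 add0r.
by rewrite val_Zp_nat // -modz_nat modz_mod nE modz_mod.
Qed.

(* Main.v *)
Require Import Defs.
From mathcomp Require Import all_boot all_order all_algebra.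
From mathcomp Require Import cyclic.
Set Implicit Arguments. Unset Strict Implicit. Unset Printing Implicit Defensive.
Import Order.TTheory GRing.Theory Num.Theory.
Local Open Scope ring_scope.

(** By Fermat's little theorem [z ^ (p - 1)] is [1] modulo [p] for every [z]
    not divisible by [p], so the fixed-point equation [z ^ (p - 1) + c = z]
    collapses to the linear equation [z = 1 + c] on nonzero classes. Hence the
    only candidates are the classes of [0] and [1 + c]
    ([fixed_points_mod_phi_sub]), and there are at most two fixed points. *)

Lemma intr_Zp_eq (p : nat) (x y : int) : (1 < p)%N ->
  (x = y %[mod p])%Z -> x%:~R = y%:~R :> 'Z_p.
Proof.
move=> p_gt1 /eqP; rewrite eqz_mod_dvd => /dvdzP[q xyE].
apply/eqP; rewrite -subr_eq0 -intrB xyE intrM.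
by rewrite -[p%:~R]/(p%:R : 'Z_p) pchar_Zp // mulr0.
Qed.

(** Only an inclusion holds: [0] is a fixed point exactly when [p] divides [c],
    while [1 + c] is one exactly when it is nonzero modulo [p]. *)
Lemma fixed_points_mod_phi_sub (p : nat) (c : int) : prime p ->
  fixed_points_mod p (phi (p - 1) c) \subset [set 0; (1 + c)%:~R].
Proof.
move=> p_prime; have p_gt1 := prime_gt1 p_prime.
apply/subsetP=> z; rewrite !inE => /eqP z_fixed.
have [//|z_neq0 /=] := eqVneq z 0.
have z_coprime : coprime z p.
  rewrite coprime_sym prime_coprime // gtnNdvd //.
    by rewrite lt0n; apply: contra_neq z_neq0 => z0; apply: val_inj.
  by rewrite -{2}(Zp_cast p_gt1) ltn_ord.
have := Euler_exp_totient z_coprime.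
rewrite totient_prime // -subn1 => /(congr1 Posz).
rewrite -!modz_nat -natz natrX natz => z_exp1.
have {}z_exp1 := intr_Zp_eq p_gt1 z_exp1.
have := intr_Zp_eq p_gt1 z_fixed; rewrite /phi !intrD intrN z_exp1 => /eqP.
by rewrite subr_eq0 -[(z : nat)%:Z%:~R]/((z : nat)%:R : 'Z_p) natr_Zp eq_sym.
Qed.

Theorem theorem1p2 (p : nat) (p_prime : prime p) (p_ge5 : (5 <= p)%N) (c : int) :
  #|fixed_points_mod p (phi (p - 1)%N c)| = 1%N \/
  #|fixed_points_mod p (phi (p - 1)%N c)| = 2%N \/
  #|fixed_points_mod p (phi (p - 1)%N c)| = 0%N.
Proof.
have := subset_leq_card (fixed_points_mod_phi_sub c p_prime).
rewrite cards2; case: #|_| => [|[|[|n]]]; [by auto .. |].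
by case: (_ != _).
Qed.
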